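(* Let $\mu$ be a probability measure on $\mathcal{Z}$, $\mu\ll\mu_0$, that satisfies the CAR assumption (relative to $\mu_0$). Thus there exists $g\in L^1(P_0)$, $g\ge 0$, with $\int_{\mathcal{Z}} g\circ\psi(z)\,\mu_0(dz|y)=1$ for $Q_0$-almost all $y$, such that the conditional distribution of $Z$ given $Y=y$ under $\mu$ is $\mu(dz|y)=g\circ\psi(z)\,\mu_0(dz|y)$. Let $h$ be the marginal density of $Y$ under $\mu$ with respect to $Q_0$, i.e. $\pi(\mu)(dy)=h(y)\,Q_0(dy)$, so that $\mu(dz)=g\circ\psi(z)\cdot h\circ\pi(z)\,\mu_0(dz)$. Then the marginal distribution of $X$ under $\mu$ is given by $$\psi(\mu)(dx)=g(x)\,S(h)(x)\,P_0(dx).$$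
   Context: Setting: $\mathcal{Z},\mathcal{Y},\mathcal{X}$ are measurable spaces (e.g. Polish spaces, so that regular conditional distributions exist), $\pi:\mathcal{Z}\to\mathcal{Y}$ and $\psi:\mathcal{Z}\to\mathcal{X}$ are measurable maps, $\mu_0$ is a fixed probability measure on $\mathcal{Z}$, $Z$ is the $\mathcal{Z}$-valued random variable (the identity on $\mathcal{Z}$), $Y=\pi(Z)$ and $X=\psi(Z)$. For a measure $\mu$ on $\mathcal{Z}$, $\pi(\mu)$ and $\psi(\mu)$ denote the image (push-forward) measures. Put $Q_0=\pi(\mu_0)$ and $P_0=\psi(\mu_0)$. $\mu_0(dz|y)$ denotes the conditional distribution of $Z$ given $Y=y$ under $\mu_0$ (a disintegration): for bounded measurable $k$ on $\mathcal{Z}$, $\int k\,d\mu_0=\int_{\mathcal{Y}}\left(\int_{\mathcal{Z}} k(z)\mu_0(dz|y)\right)Q_0(dy)$, and $\mu_0(\{z:\pi(z)\ne y\}|y)=0$ for $Q_0$-almost all $y$. CAR assumption (relative to $\mu_0$): a probability measure $\mu\ll\mu_0$ on $\mathcal{Z}$ satisfies CAR if and only if $\mu(dz)=g\circ\psi(z)\cdot h\circ\pi(z)\,\mu_0(dz)$, where $h$ is a probability density with respect to $Q_0$ and $g$ is a positive (i.e. $\ge 0$) measurable function on $\mathcal{X}$ such that $\int_{\mathcal{Z}} g\circ\psi(z)\,\mu_0(dz|y)=1$ for $Q_0$-almost all $y$ (equivalently $E_{\mu_0}(g(X)|Y)=1$). In that case $h$ is the marginal density of $Y$ with respect to $Q_0$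 and the conditional distribution of $Z$ given $Y=y$ is $g\circ\psi(z)\mu_0(dz|y)$. The linear map $S:L^1(Q_0)\to L^1(P_0)$ is defined by $S(h)(x)=E_{\mu_0}(h(Y)|X=x)$. *)

(* Defs.v *)
From HB Require Import structures.
From mathcomp Require Import all_boot all_order all_algebra.
From mathcomp Require Import all_classical all_reals all_analysis.
From mathcomp Require Import measurable_realfun.

Set Implicit Arguments.
Unset Strict Implicit.
Unset Printing Implicit Defensive.

Import Order.TTheory GRing.Theory Num.Theory.
Import numFieldNormedType.Exports.

Local Open Scope classical_set_scope.
Local Open Scope ring_scope.
Local Open Scope ereal_scope.

(* [weighted m f0] is the measure f(t) m(dt), for f measurable and f0 a proof
   that f is nonnegative. *)
Section weighted.
Context d (T : measurableType d) (R : realType).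
Variables (m : {measure set T -> \bar R}) (f : {mfun T >-> R}).

Definition weighted (f0 : forall t, (0 <= f t)%R) : set T -> \bar R :=
  fun A => \int[m]_(t in A) (f t)%:E.

Variable f0 : forall t, (0 <= f t)%R.

Let weighted0 : weighted f0 set0 = 0.
Proof. exact: integral_set0. Qed.

Let weighted_ge0 A : 0 <= weighted f0 A.
Proof. by apply: integral_ge0 => t _; rewrite lee_fin. Qed.

Let weighted_sigma_additive : semi_sigma_additive (weighted f0).
Proof.
apply: semi_sigma_additive_nng_induced => [|t]; last by rewrite lee_fin.
exact/measurable_EFinP.
Qed.

HB.instance Definition _ := isMeasure.Build _ _ _ (weighted f0)
  weighted0 weighted_ge0 weighted_sigma_additive.

End weighted.

(* nu(dt) = f(t) m(dt).  The integrability clause makes f an element of L^1(m);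
   it is automatic when nu is finite, and it rules out integrals of the form
   oo - oo for functions that are nonnegative only almost everywhere. *)
Definition has_density d (T : measurableType d) (R : realType)
    (nu : set T -> \bar R) (m : {measure set T -> \bar R}) (f : T -> R) : Prop :=
  m.-integrable setT (EFin \o f) /\
  forall A, measurable A -> nu A = \int[m]_(t in A) (f t)%:E.

Definition is_probability_density d (T : measurableType d) (R : realType)
    (m : {measure set T -> \bar R}) (f : T -> R) : Prop :=
  [/\ measurable_fun setT f, forall t, (0 <= f t)%R & \int[m]_t (f t)%:E = 1].

(* K y is the conditional distribution, given Y = y, of the identity variable Z
   under mu, where Y = p(Z).  The fibre condition is expressed with [{ae _, _}]
   because {z | p z <> y} need not be measurable in a general measurable space. *)
Definition is_disintegration dZ dY (Z : measurableType dZ)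
    (Y : measurableType dY) (R : realType) (mu : probability Z R)
    (p : {mfun Z >-> Y}) (K : Y -> {measure set Z -> \bar R}) : Prop :=
  [/\ forall A, measurable A -> measurable_fun setT (fun y => K y A),
      forall k : {mfun Z >-> R}, bounded_fun k ->
        \int[mu]_z (k z)%:E =
        \int[distribution mu p]_y \int[K y]_z (k z)%:E &
      {ae distribution mu p, forall y, {ae K y, forall z, p z = y}}].

(* s(x) = E_mu(W | X = x) for the random element X, in Kolmogorov's sense. *)
Definition is_cond_expectation dZ dX (Z : measurableType dZ)
    (X : measurableType dX) (R : realType) (mu : probability Z R)
    (V : {mfun Z >-> X}) (W : Z -> R) (s : X -> R) : Prop :=
  (distribution mu V).-integrable setT (EFin \o s) /\
  forall B, measurable B ->
    \int[distribution mu V]_(x in B) (s x)%:E =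
    \int[mu]_(z in V @^-1` B) (W z)%:E.

(* A chosen version of the conditional expectation; see [cond_expectationP]. *)
Definition cond_expectation dZ dX (Z : measurableType dZ)
    (X : measurableType dX) (R : realType) (mu : probability Z R)
    (V : {mfun Z >-> X}) (W : Z -> R) : X -> R :=
  xget (fun=> 0%R) [set s | is_cond_expectation mu V W s].

Lemma cond_expectationP dZ dX (Z : measurableType dZ)
    (X : measurableType dX) (R : realType) (mu : probability Z R)
    (V : {mfun Z >-> X}) (W : Z -> R) :
  mu.-integrable setT (EFin \o W) ->
  is_cond_expectation mu V W (cond_expectation mu V W).
Proof.
move=> intW.
suff [s ?] : exists s, is_cond_expectation mu V W s by apply: xgetPex; exists s.
pose nu0 : {charge set Z -> \bar R} := induced_charge intW.
have mV : measurable_fun setT V by [].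
have [nu nuE] : exists nu : {charge set X -> \bar R},
    forall B, nu B = \int[mu]_(z in V @^-1` B) (W z)%:E.
  by unshelve eexists; [exact: (pushforward nu0 V)|].
pose P : probability X R := distribution mu V.
have nuP : nu `<< P.
  apply/null_content_dominatesP => B mB PB0.
  have mVB : measurable (V @^-1` B) by exact: measurable_funPTI.
  rewrite nuE; apply: null_set_integral => //.
  exact: measurable_funTS (measurable_int mu intW).
pose s0 := Radon_Nikodym nu P.
have s0E x : (fine (s0 x))%:E = s0 x by rewrite fineK// Radon_Nikodym_fin_num.
exists (fine \o s0); split.
  rewrite (_ : EFin \o _ = s0); first exact: Radon_Nikodym_integrable.
  by apply/funext => x /=; exact: s0E.
move=> B mB; under eq_integral do rewrite /= s0E.
by rewrite -Radon_Nikodym_integral// nuE.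
Qed.

(* The operator S : L^1(Q0) -> L^1(P0), acting on representatives, with
   Q0 and P0 the laws of p(Z) and psi(Z) under mu0. *)
Definition S_op dZ dY dX (Z : measurableType dZ) (Y : measurableType dY)
    (X : measurableType dX) (R : realType) (mu0 : probability Z R)
    (p : {mfun Z >-> Y}) (psi : {mfun Z >-> X}) (h : Y -> R) : X -> R :=
  cond_expectation mu0 psi (h \o p).

Section coarsening_at_random.
Context dZ dY dX (Z : measurableType dZ) (Y : measurableType dY)
  (X : measurableType dX) (R : realType).
Variables (mu0 : probability Z R) (p : {mfun Z >-> Y}) (psi : {mfun Z >-> X}).
Variables (kappa : R.-pker Y ~> Z) (mu : probability Z R).

Definition CAR : Prop :=
  exists (g : {mfun X >-> R}) (h : Y -> R),
    [/\ forall x, (0 <= g x)%R,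
        {ae distribution mu0 p,
          forall y, \int[kappa y]_z (g (psi z))%:E = 1},
        is_probability_density (distribution mu0 p) h &
        has_density mu mu0 (fun z => g (psi z) * h (p z))%R].

Definition is_CAR_factor (g : {mfun X >-> R}) : Prop :=
  exists g0 : forall x, (0 <= g x)%R,
    [/\ (distribution mu0 psi).-integrable setT (EFin \o g),
        {ae distribution mu0 p,
          forall y, \int[kappa y]_z (g (psi z))%:E = 1} &
        is_disintegration mu p
          (fun y => weighted (kappa y) (f := g \o psi) (fun z => g0 (psi z)))].

End coarsening_at_random.

(* Main.v *)
Require Import Defs.
From HB Require Import structures.
From mathcomp Require Import all_boot all_order all_algebra.
From mathcomp Require Import all_classical all_reals all_analysis.
From mathcomp Require Import measurable_realfun.

Set Implicit Arguments.
Unset Strict Implicit.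
Unset Printing Implicit Defensive.

Import Order.TTheory GRing.Theory Num.Theory.
Import numFieldNormedType.Exports.

Local Open Scope classical_set_scope.
Local Open Scope ring_scope.

(** Write Q0 and P0 for the laws of Y = p(Z) and X = psi(Z) under mu0.  By the
    tower property, for B measurable in X,

      mu(X in B) = E_mu0[1_B(X) g(X) h(Y)] = E_mu0[1_B(X) g(X) E_mu0[h(Y) | X]],

    and the last expectation is the integral of g S(h) over B against P0.  This
    is the second density claim once mu is known to have density
    g(psi z) h(p z), and the latter comes from the disintegration: integrating
    first over the fibres of p, where h(p z) is the constant h(y),

      E_mu0[1_A(Z) g(X) h(Y)] = int h(y) (int_A g(psi z) kappa(dz|y)) Q0(dy),

    which is the mass of A under the mixture of the measures g kappa(.|y)
    against the law h Q0 of Y under mu ([CAR_mixture]).  Read from right to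
    left, the same identity shows that the function g in the CAR hypothesis is
    a CAR factor ([CAR_factor]); its normalisation int g kappa(dz|y) = 1 is what
    makes h Q0 the law of Y ([CAR_marginal]).

    The definitions speak of measures of sets and of bounded functions, while
    g and h are unbounded, so one principle carries the measure theory: an
    identity nu(A) = int K(x)(A) m(dx) between masses extends to all nonnegative
    integrands ([integral_mixture]).  It yields at once the integration rule for
    a density, with K(x) a multiple of a Dirac mass, and the fibrewise
    integration rule of a disintegration ([integral_fibre]).

    The given density h, and the version of S(h), are nonnegative only almost
    everywhere.  Both are densities of measures, which forces nonnegativity
    almost everywhere, so each is replaced by an everywhere nonnegative
    version ([density_posrep]); all integrals computed below are then of
    nonnegative functions, and integrability comes at the end for free from the
    finiteness of mu ([has_density_ae]). *)

(** * Mixtures of measures *)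

Section mixtures.
Local Open Scope ereal_scope.
Context d1 d2 (T1 : measurableType d1) (T2 : measurableType d2) (R : realType).
Variables (m : {measure set T1 -> \bar R}) (nu : {measure set T2 -> \bar R})
  (K : T1 -> {measure set T2 -> \bar R}).
Hypothesis mK : forall A, measurable A -> measurable_fun setT (K ^~ A).
Hypothesis nuK : forall A, measurable A -> nu A = \int[m]_x K x A.

Import HBNNSimple.

Let integral_mixture_nnsfun (f : {nnsfun T2 >-> R}) :
  \int[nu]_z (f z)%:E = \int[m]_x \int[K x]_z (f z)%:E.
Proof.
under [RHS]eq_integral do rewrite integralT_nnsfun sintegralE.
rewrite integralT_nnsfun sintegralE ge0_integral_fsum//; last 2 first.
- move=> r; apply: emeasurable_funM; first exact: measurable_cst.
  exact: mK.
- by move=> r x _; exact: nnsfun_mulemu_ge0.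
apply: eq_fsbigr => r _.
have mfr : measurable (f @^-1` [set r]) by exact: measurable_funPTI.
(* The sum runs over all reals; for r < 0 the fibre of f is empty. *)
have [r0|r0] := leP 0%R r.
  by rewrite ge0_integralZl// ?lee_fin// ?nuK//; exact: mK.
rewrite integral0_eq => [|x _]; rewrite preimage_nnfun0// measure0 mule0//.
Qed.

(** For simple f this is linearity, and both sides are continuous along
    increasing sequences of simple functions. *)
Lemma integral_mixture (f : T2 -> \bar R) :
  (forall z, 0 <= f z) -> measurable_fun setT f ->
  \int[nu]_z f z = \int[m]_x \int[K x]_z f z.
Proof.
move=> f0 mf; pose f_ := nnsfun_approx measurableT mf.
have mf_ n : measurable_fun setT (EFin \o f_ n) by exact/measurable_EFinP.
have f_0 n z : 0 <= (EFin \o f_ n) z by rewrite lee_fin.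
have ndf z : {homo (fun n => (EFin \o f_ n) z) : i j / (i <= j)%N >-> i <= j}.
  by move=> i j ij; rewrite lee_fin; exact/lefP/nd_nnsfun_approx.
have int_f (l : {measure set T2 -> \bar R}) :
    \int[l]_z f z = limn (fun n => \int[l]_z (f_ n z)%:E).
  rewrite -(monotone_convergence l measurableT (g' := fun n z => (f_ n z)%:E)
    mf_ (fun n z _ => f_0 n z) (fun z _ => ndf z)).
  apply: eq_integral => z _.
  by apply/esym/cvg_lim => //; exact: cvg_nnsfun_approx.
rewrite int_f; under [RHS]eq_integral do rewrite int_f.
rewrite monotone_convergence//.
- by congr (limn _); apply/funext => n; exact: integral_mixture_nnsfun.
- by move=> n; exact: (measurable_fun_integral_kernel mK (f_0 n) (mf_ n)).
- by move=> n x _; apply: integral_ge0 => z _; exact: f_0.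
- move=> x _ i j ij; apply: ge0_le_integral => //.
  + by move=> z _; exact: f_0.
  + exact: mf_.
  + exact: mf_.
  + by move=> z _; exact: ndf.
Qed.

End mixtures.

(** * Measures with a density *)

Section densities.
Local Open Scope ereal_scope.
Context d (T : measurableType d) (R : realType).
Implicit Types (m nu : {measure set T -> \bar R}).

(** A measure f(t) m(dt) is the mixture against m of the point masses
    f(t) delta_t. *)
Lemma ge0_integral_density nu m (f : {mfun T >-> R}) (k : T -> \bar R) :
  (forall t, (0 <= f t)%R) ->
  (forall A, measurable A -> nu A = \int[m]_(t in A) (f t)%:E) ->
  (forall t, 0 <= k t) -> measurable_fun setT k ->
  \int[nu]_t k t = \int[m]_t ((f t)%:E * k t).
Proof.
move=> f0 nuE k0 mk.
pose K t : {measure set T -> \bar R} := mscale (NngNum (f0 t)) (dirac t).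
have KE t A : K t A = (f t)%:E * (\1_A t)%:E by [].
rewrite (@integral_mixture _ _ _ _ _ m nu K)//.
- apply: eq_integral => t _.
  by rewrite ge0_integral_mscale// integral_dirac// diracT mul1e.
- move=> A mA; under eq_fun do rewrite KE; apply: emeasurable_funM.
    exact/measurable_EFinP.
  by apply/measurable_EFinP; exact: measurable_indic.
- move=> A mA; rewrite nuE// integral_mkcond epatch_indic.
  by apply: eq_integral.
Qed.

Lemma ae_dominated nu m (P : T -> Prop) :
  (forall A, measurable A -> m A = 0 -> nu A = 0) ->
  {ae m, forall t, P t} -> {ae nu, forall t, P t}.
Proof. by move=> num [N [mN N0 PN]]; exists N; split => //; exact: num. Qed.

Lemma null_integral m (f : {mfun T >-> R}) A : measurable A -> m A = 0 ->
  \int[m]_(t in A) (f t)%:E = 0.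
Proof.
move=> mA A0; apply: null_set_integral => //.
by apply/measurable_funTS/measurable_EFinP.
Qed.

(** On every measurable part E of the set where f < 0, the integral of f is both
    nonpositive and equal to nu(E) >= 0, hence zero; so f vanishes almost
    everywhere on that set. *)
Lemma density_ge0 nu m (f : T -> R) :
  has_density nu m f -> {ae m, forall t, (0 <= f t)%R}.
Proof.
move=> [intf nuE].
have mf : measurable_fun setT f by exact/measurable_EFinP/(measurable_int m).
pose N := [set t | (f t < 0)%R].
have mN : measurable N.
  rewrite [N](_ : _ = f @^-1` `]-oo, 0%R[).
    by rewrite -[X in measurable X]setTI; exact: mf.
  by apply/seteqP; split => t /=; rewrite in_itv.
have : ae_eq m N (EFin \o f) (cst 0).
  apply: integral_ae_eq => //; first exact: integrableS intf.
  move=> E EN mE; apply/eqP; rewrite integral0 eq_le; apply/andP; split.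
    rewrite -(integral0 m E); apply: le_integral => //.
    - exact: integrableS intf.
    - exact: integrable0.
    - by move=> t /set_mem/EN ft; rewrite lee_fin; exact: ltW.
  by rewrite -nuE.
apply: filterS => t /= fN; rewrite leNgt; apply/negP => ft.
by have := fN ft; case => f0; rewrite f0 ltxx in ft.
Qed.

(** The everywhere nonnegative version that makes [ge0_integral_density]
    available for a density known only in the sense of L^1; it is the positive
    part of f. *)
Lemma density_posrep nu m (f : T -> R) : has_density nu m f ->
  exists f' : {mfun T >-> R}, [/\ forall t, (0 <= f' t)%R,
    {ae m, forall t, f t = f' t} &
    forall A, measurable A -> nu A = \int[m]_(t in A) (f' t)%:E].
Proof.
move=> fD; have [intf nuE] := fD.
have mf : measurable_fun setT f by exact/measurable_EFinP/(measurable_int m).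
have mf' : measurable_fun setT (fun t => Num.max (f t) 0%R).
  by apply: measurable_maxr.
have f'P : (fun t => Num.max (f t) 0%R) \in mfun by rewrite inE.
have aeE : {ae m, forall t, f t = Num.max (f t) 0%R}.
  by apply: filterS (density_ge0 fD) => t ft; rewrite max_l.
exists (mfun_Sub f'P); split => //= [t|A mA].
  by rewrite le_max lexx orbT.
rewrite nuE//; apply: ae_eq_integral => //.
- by apply/measurable_funTS/measurable_EFinP.
- by apply/measurable_funTS/measurable_EFinP.
- by apply: filterS aeE => t <-.
Qed.

(** The way back from a nonnegative version f' to the original f: integrability
    holds because the integral of f' is the total mass of nu. *)
Lemma has_density_ae nu m (f f' : T -> R) :
  nu setT < +oo -> measurable_fun setT f -> measurable_fun setT f' ->
  (forall t, (0 <= f' t)%R) -> {ae m, forall t, f t = f' t} ->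
  (forall A, measurable A -> nu A = \int[m]_(t in A) (f' t)%:E) ->
  has_density nu m f.
Proof.
move=> nufin mf mf' f'0 ff' nuE.
have mEf : measurable_fun setT (EFin \o f) by exact/measurable_EFinP.
have mEf' : measurable_fun setT (EFin \o f') by exact/measurable_EFinP.
split; last first.
  move=> A mA; rewrite nuE//; apply: ae_eq_integral => //.
  - exact: measurable_funTS.
  - exact: measurable_funTS.
  - by apply: filterS ff' => t ->.
apply/integrableP; split => //.
rewrite (_ : \int[m]_t _ = nu setT)// nuE//; apply: ae_eq_integral => //.
- exact: measurableT_comp.
- by apply: filterS ff' => t /= -> _; rewrite ger0_norm.
Qed.

Lemma integral_weighted m (f : {mfun T >-> R}) (f0 : forall t, (0 <= f t)%R)
    (k : T -> \bar R) :
  (forall t, 0 <= k t) -> measurable_fun setT k ->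
  \int[weighted m f0]_t k t = \int[m]_t ((f t)%:E * k t).
Proof. by move=> k0 mk; exact: ge0_integral_density. Qed.

Lemma weightedE m (f : {mfun T >-> R}) (f0 : forall t, (0 <= f t)%R) A :
  weighted m f0 A = \int[m]_t ((f t)%:E * (\1_A t)%:E).
Proof. by rewrite /weighted integral_mkcond epatch_indic. Qed.

End densities.

(** * Disintegrations *)

Section disintegrations.
Local Open Scope ereal_scope.
Context dZ dY (Z : measurableType dZ) (Y : measurableType dY) (R : realType).
Variables (mu : probability Z R) (p : {mfun Z >-> Y})
  (K : Y -> {measure set Z -> \bar R}).

Lemma disintegration_mass : is_disintegration mu p K ->
  forall A, measurable A -> mu A = \int[distribution mu p]_y K y A.
Proof.
move=> [mK muK _] A mA.
have mA1 : (\1_A : Z -> R) \in mfun by rewrite inE; exact: measurable_indic.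
have bA1 : bounded_fun (mfun_Sub mA1).
  exists 1%R; split => // x x1 z _ /=.
  rewrite normr_nat (le_trans _ (ltW x1))//.
  by rewrite lern1 leq_b1.
have := muK _ bA1; rewrite /= integral_indic// setIT => ->.
by apply: eq_integral => y _; rewrite integral_indic// setIT.
Qed.

(** Checking the masses of sets is enough.  The measures K y may be infinite for
    y in a null set, so the positive and negative parts of a bounded k are
    integrated separately; each inner integral is integrable in y because its
    outer integral is that of k^+ or k^- under mu. *)
Lemma mass_disintegration :
  (forall A, measurable A -> measurable_fun setT (K ^~ A)) ->
  (forall A, measurable A -> mu A = \int[distribution mu p]_y K y A) ->
  {ae distribution mu p, forall y, {ae K y, forall z, p z = y}} ->
  is_disintegration mu p K.
Proof.
move=> mK muK fib; split => // k bk.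
have mk : measurable_fun setT (EFin \o k) by exact/measurable_EFinP.
have ik : mu.-integrable setT (EFin \o k).
  by apply: measurable_bounded_integrable => //;
    exact: le_lt_trans (probability_le1 _ _) (ltry 1%R).
have intK (f : Z -> \bar R) : (forall z, 0 <= f z) -> mu.-integrable setT f ->
    \int[mu]_z f z = \int[distribution mu p]_y \int[K y]_z f z /\
    (distribution mu p).-integrable setT (fun y => \int[K y]_z f z).
  move=> f0 /integrableP[mf foo].
  have fE : \int[mu]_z f z = \int[distribution mu p]_y \int[K y]_z f z.
    exact: integral_mixture.
  split => //; apply/integrableP; split.
    exact: measurable_fun_integral_kernel.
  under eq_integral do rewrite gee0_abs ?integral_ge0//.
  rewrite -fE; under eq_integral do rewrite -[f _]gee0_abs//.
  exact: foo.
have [posE ipos] :=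
  intK _ (funepos_ge0 (EFin \o k)) (integrable_funepos measurableT ik).
have [negE ineg] :=
  intK _ (funeneg_ge0 (EFin \o k)) (integrable_funeneg measurableT ik).
rewrite integralE posE negE -integralB//.
by apply: eq_integral => y _; rewrite [RHS]integralE.
Qed.

End disintegrations.

Section fibres.
Local Open Scope ereal_scope.
Context dZ dY (Z : measurableType dZ) (Y : measurableType dY) (R : realType).
Variables (mu : probability Z R) (p : {mfun Z >-> Y})
  (K : Y -> {measure set Z -> \bar R}).
Hypothesis HK : is_disintegration mu p K.

(** On the fibre over y, that is K y-almost everywhere, k (p z) is the constant
    k y and leaves the inner integral. *)
Lemma integral_fibre (k : Y -> \bar R) (f : Z -> \bar R) :
  (forall y, 0 <= k y) -> measurable_fun setT k ->
  (forall z, 0 <= f z) -> measurable_fun setT f ->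
  \int[mu]_z (k (p z) * f z) =
  \int[distribution mu p]_y (k y * \int[K y]_z f z).
Proof.
move=> k0 mk f0 mf; have [mK _ fib] := HK.
have mkp : measurable_fun setT (k \o p) by exact: measurableT_comp.
have mkf : measurable_fun setT (fun z => k (p z) * f z).
  exact: emeasurable_funM.
rewrite (integral_mixture mK (disintegration_mass HK))//; last first.
  by move=> z; exact: mule_ge0.
apply: ge0_ae_eq_integral => //.
- by apply: measurable_fun_integral_kernel => // z; exact: mule_ge0.
- by apply: emeasurable_funM => //; exact: measurable_fun_integral_kernel.
- by move=> y _; apply: integral_ge0 => z _; exact: mule_ge0.
- by move=> y _; apply: mule_ge0 => //; exact: integral_ge0.
apply: filterS fib => y fib_y _.
rewrite -ge0_integralZl//; apply: ae_eq_integral => //.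
- by apply: emeasurable_funM => //; exact: measurable_cst.
- by apply: filterS fib_y => z -> _.
Qed.

End fibres.

(** * Coarsening at random *)

Section car.
Local Open Scope ereal_scope.
Context dZ dY dX (Z : measurableType dZ) (Y : measurableType dY)
  (X : measurableType dX) (R : realType).
Variables (mu0 : probability Z R) (p : {mfun Z >-> Y}) (psi : {mfun Z >-> X}).
Variables (kappa : R.-pker Y ~> Z).
Hypothesis Hkappa : is_disintegration mu0 p kappa.
Variables (g : {mfun X >-> R}) (g0 : forall x, (0 <= g x)%R).

Let K y : {measure set Z -> \bar R} :=
  weighted (kappa y) (f := g \o psi) (fun z => g0 (psi z)).

Let KE y A : K y A = \int[kappa y]_z ((g (psi z))%:E * (\1_A z)%:E).
Proof. exact: weightedE. Qed.

Let mgpsi : measurable_fun setT (fun z => (g (psi z))%:E).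
Proof. by apply/measurable_EFinP; exact: measurableT_comp. Qed.

Let gpsi0 z : 0 <= (g (psi z))%:E.
Proof. by rewrite lee_fin. Qed.

Let mgpsi1 A : measurable A ->
  measurable_fun setT (fun z => (g (psi z))%:E * (\1_A z)%:E).
Proof.
move=> mA; apply: emeasurable_funM => //.
by apply/measurable_EFinP; exact: measurable_indic.
Qed.

Let gpsi10 A z : 0 <= (g (psi z))%:E * (\1_A z)%:E.
Proof. by apply: mule_ge0; rewrite // lee_fin. Qed.

Lemma measurable_weighted_kernel A :
  measurable A -> measurable_fun setT (K ^~ A).
Proof.
move=> mA; under eq_fun do rewrite KE.
apply: measurable_fun_integral_kernel => //; last exact: mgpsi1.
by move=> U mU; have [mk _ _] := Hkappa; exact: mk.
Qed.

(** Links the two descriptions of mu: on the left a mixture of the conditional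
    distributions g kappa(.|y) against a law h Q0 of Y, on the right a density
    with respect to mu0.  It serves in both directions. *)
Lemma CAR_mixture (Q : {measure set Y -> \bar R}) (h : {mfun Y >-> R}) A :
  (forall y, (0 <= h y)%R) ->
  (forall B, measurable B ->
    Q B = \int[distribution mu0 p]_(y in B) (h y)%:E) ->
  measurable A ->
  \int[Q]_y K y A = \int[mu0]_(z in A) (g (psi z) * h (p z))%:E.
Proof.
move=> h0 QE mA; rewrite (ge0_integral_density h0 QE)//; last first.
  exact: measurable_weighted_kernel.
under eq_integral do rewrite KE.
rewrite -(integral_fibre Hkappa (k := EFin \o h))//.
- rewrite [RHS]integral_mkcond epatch_indic; apply: eq_integral => z _ /=.
  by rewrite EFinM muleCA muleA.
- exact/measurable_EFinP.
- exact: mgpsi1.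
Qed.

(** Fibrewise, 1_B(y) h(y) is constant and the remaining factor g has kappa-mean
    1; so h is the density of the law of Y when g(psi z) h(p z) is that of
    mu. *)
Lemma CAR_marginal (h : {mfun Y >-> R}) B :
  (forall y, (0 <= h y)%R) ->
  {ae distribution mu0 p, forall y, \int[kappa y]_z (g (psi z))%:E = 1} ->
  measurable B ->
  \int[mu0]_(z in p @^-1` B) (g (psi z) * h (p z))%:E =
  \int[distribution mu0 p]_(y in B) (h y)%:E.
Proof.
move=> h0 g1 mB.
have mhB : measurable_fun setT (fun y => (h y)%:E * (\1_B y)%:E).
  apply: emeasurable_funM; first exact/measurable_EFinP.
  by apply/measurable_EFinP; exact: measurable_indic.
have hB0 y : 0 <= (h y)%:E * (\1_B y)%:E by rewrite mule_ge0// lee_fin.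
transitivity (\int[mu0]_z ((h (p z))%:E * (\1_B (p z))%:E * (g (psi z))%:E)).
  rewrite integral_mkcond epatch_indic; apply: eq_integral => z _ /=.
  by rewrite EFinM -muleA muleC.
rewrite (integral_fibre Hkappa hB0 mhB gpsi0 mgpsi).
rewrite [RHS]integral_mkcond epatch_indic; apply: ae_eq_integral => //.
- apply: emeasurable_funM => //; apply: measurable_fun_integral_kernel => //.
  by have [] := Hkappa.
- by apply: filterS g1 => y -> _; rewrite mule1.
Qed.

(** Integrability of g is the case k = 1 of [integral_fibre], which makes g of
    mean 1 under P0.  The fibre condition passes from mu0 to mu because
    the law of Y and the measures g kappa(.|y) have densities with respect to
    their counterparts Q0 and kappa(.|y). *)
Lemma CAR_factor (mu : probability Z R) (h : {mfun Y >-> R}) :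
  (forall y, (0 <= h y)%R) ->
  {ae distribution mu0 p, forall y, \int[kappa y]_z (g (psi z))%:E = 1} ->
  (forall A, measurable A ->
    mu A = \int[mu0]_(z in A) (g (psi z) * h (p z))%:E) ->
  is_CAR_factor mu0 p psi kappa mu g.
Proof.
move=> h0 g1 muE; exists g0.
have QE B : measurable B ->
    distribution mu p B = \int[distribution mu0 p]_(y in B) (h y)%:E.
  move=> mB; rewrite -CAR_marginal//; apply: muE.
  exact: measurable_funPTI.
split => //.
- apply/integrableP; split; first exact/measurable_EFinP.
  rewrite ge0_integral_pushforward//; last first.
    exact/measurableT_comp/measurable_EFinP.
  rewrite preimage_setT.
  under eq_integral do rewrite /= -[_%:E]mul1e ger0_norm//.
  rewrite (integral_fibre Hkappa (k := cst 1))//.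
  under eq_integral do rewrite mul1e.
  rewrite (_ : integral _ _ _ = \int[distribution mu0 p]_y 1).
    rewrite integral_cst// mul1e.
    exact: le_lt_trans (probability_le1 _ _) (ltry 1%R).
  apply: ae_eq_integral => //.
  + by apply: measurable_fun_integral_kernel => //; have [] := Hkappa.
  + by apply: filterS g1 => y -> _.
- apply: mass_disintegration.
  + exact: measurable_weighted_kernel.
  + by move=> A mA; rewrite (CAR_mixture h0 QE)// muE.
  + apply: (ae_dominated (m := distribution mu0 p)).
      by move=> B mB B0; apply: etrans (QE _ mB) _; exact: null_integral.
    have [_ _] := Hkappa; apply: filterS => y.
    by apply: ae_dominated => A mA A0; exact: null_integral.
Qed.

End car.

(** * Conditional expectation of a nonnegative variable *)

Section conditioning.
Local Open Scope ereal_scope.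
Context dZ dX (Z : measurableType dZ) (X : measurableType dX) (R : realType).
Variables (mu0 : probability Z R) (psi : {mfun Z >-> X}).

(** Taking out what is known, f(X) E[W | X] = E[f(X) W | X] in the mean, for
    unbounded f >= 0.  By definition s is the density with respect to P0 of the
    image under psi of the measure W mu0; integrating f against this image in
    two ways gives the identity, and being a density is also what makes s
    nonnegative almost everywhere. *)
Lemma cond_expectation_posrep (W : {mfun Z >-> R}) (s : X -> R) :
  (forall z, (0 <= W z)%R) -> is_cond_expectation mu0 psi W s ->
  exists s' : {mfun X >-> R}, [/\ forall x, (0 <= s' x)%R,
    {ae distribution mu0 psi, forall x, s x = s' x} &
    forall f : X -> \bar R, (forall x, 0 <= f x) -> measurable_fun setT f ->
      \int[distribution mu0 psi]_x ((s' x)%:E * f x) =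
      \int[mu0]_z ((W z)%:E * f (psi z))].
Proof.
move=> W0 [ints sE].
have mpsi : measurable_fun setT psi by [].
(* The image measure is given a name because the measure structure on
   [pushforward] cannot be inferred without the measurability of psi. *)
have [nu nuE] : exists nu : {measure set X -> \bar R},
    nu = pushforward (weighted mu0 W0) psi :> (set X -> \bar R).
  by unshelve eexists; [exact: (pushforward (weighted mu0 W0) psi)|].
have : has_density nu (distribution mu0 psi) s.
  by split => // B mB; rewrite sE// nuE.
move=> /density_posrep[s' [s'0 ss' nus']]; exists s'; split => // f f0 mf.
rewrite -(ge0_integral_density s'0 nus')//.
have -> : \int[nu]_x f x = \int[pushforward (weighted mu0 W0) psi]_x f x.
  by apply: eq_measure_integral => A mA _; rewrite nuE.
rewrite ge0_integral_pushforward// preimage_setT integral_weighted//.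
- by move=> z; exact: f0.
- exact: measurableT_comp.
Qed.

End conditioning.

(** * The law of X *)

Theorem proposition1p2 (R : realType) (dZ dY dX : measure_display)
    (Z : measurableType dZ) (Y : measurableType dY) (X : measurableType dX)
    (p : {mfun Z >-> Y}) (psi : {mfun Z >-> X}) (mu0 : probability Z R)
    (kappa : R.-pker Y ~> Z) (Hkappa : is_disintegration mu0 p kappa)
    (mu : probability Z R) (Hmu : mu `<< mu0)
    (Hcar : CAR mu0 p psi kappa mu) :
  (exists g : {mfun X >-> R}, is_CAR_factor mu0 p psi kappa mu g) /\
  (forall (g : {mfun X >-> R}) (h : Y -> R),
     is_CAR_factor mu0 p psi kappa mu g ->
     has_density (distribution mu p) (distribution mu0 p) h ->
     has_density mu mu0 (fun z => g (psi z) * h (p z)) /\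
     has_density (distribution mu psi) (distribution mu0 psi)
       (fun x => g x * S_op mu0 p psi h x)).
Proof.
split.
  have [g [h [g0 g1 [mh h0 _] [_ muE]]]] := Hcar.
  have hP : h \in mfun by rewrite inE.
  by exists g; apply: (CAR_factor Hkappa g0 (h := mfun_Sub hP)).
move=> g h [g0 [_ _ mu_dis]] hD.
have [h' [h'0 hh' QE]] := density_posrep hD.
have mh : measurable_fun setT h.
  by have [/measurable_int/measurable_EFinP] := hD.
have muE A : measurable A ->
    mu A = (\int[mu0]_(z in A) (g (psi z) * h' (p z))%:E)%E.
  move=> mA; rewrite (disintegration_mass mu_dis mA).
  by rewrite -(CAR_mixture psi Hkappa g0 h'0 QE mA).
have hh'p : {ae mu0, forall z, h (p z) = h' (p z)}.
  have [N [mN N0 hN]] := hh'; exists (p @^-1` N); split => //.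
    exact: measurable_funPTI.
  by move=> z; exact: hN.
have mgpsi : measurable_fun setT (g \o psi) by exact: measurableT_comp.
have gh'0 z : 0 <= g (psi z) * h' (p z) by exact: mulr_ge0.
have mgh' : measurable_fun setT (fun z => g (psi z) * h' (p z)).
  by apply: measurable_funM => //; exact: measurableT_comp.
split.
  apply: (has_density_ae (f' := fun z => g (psi z) * h' (p z))) => //.
  - exact: le_lt_trans (probability_le1 _ _) (ltry 1%R).
  - by apply: measurable_funM => //; exact: measurableT_comp.
  - by apply: filterS hh'p => z ->.
have inth : mu0.-integrable setT (EFin \o (h \o p)).
  have [/integrableP[mEh hoo] _] := hD; apply/integrableP; split.
    exact: (measurableT_comp mEh (measurable_funPT p)).
  move: hoo; rewrite ge0_integral_pushforward//; exact: measurableT_comp.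
(* S(h) is a version for the nonnegative h' as well, since h = h' almost
   everywhere. *)
have sP : is_cond_expectation mu0 psi (h' \o p) (S_op mu0 p psi h).
  have [ints sE] := cond_expectationP psi inth; split => // B mB.
  rewrite sE//; apply: ae_eq_integral => //.
  - exact: measurable_funPTI.
  - by apply/measurable_funTS/measurable_EFinP; exact: measurableT_comp.
  - by apply/measurable_funTS/measurable_EFinP; exact: measurableT_comp.
  - by apply: filterS hh'p => z /= ->.
have [s' [s'0 ss' s'E]] := @cond_expectation_posrep _ _ _ _ _ mu0 psi
  (h' \o p) _ (fun z => h'0 (p z)) sP.
apply: (has_density_ae (f' := fun x => g x * s' x)) => //.
- exact: le_lt_trans (probability_le1 _ _) (ltry 1%R).
- apply: measurable_funM => //.
  by have [/measurable_int/measurable_EFinP] := sP.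
- by apply: measurable_funM.
- by move=> x; exact: mulr_ge0.
- by apply: filterS ss' => x ->.
move=> B mB.
rewrite [LHS]muE; last exact: measurable_funPTI.
rewrite [LHS]integral_mkcond [RHS]integral_mkcond !epatch_indic.
transitivity (\int[mu0]_z
    ((h' (p z))%:E * ((g (psi z))%:E * (\1_B (psi z))%:E)))%E.
  by apply: eq_integral => z _ /=; rewrite EFinM muleCA muleA.
rewrite -(s'E (fun x => (g x)%:E * (\1_B x)%:E)%E)//.
- by apply: eq_integral => x _ /=; rewrite EFinM muleCA muleA.
- by move=> x; rewrite mule_ge0// lee_fin.
- apply: emeasurable_funM; first exact/measurable_EFinP.
  by apply/measurable_EFinP; exact: measurable_indic.
Qed.
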